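(* Let $1\le p\le n$, let $U\in St_p^n$, and let $I_p\subset\{1,\dots,n\}$ be a set of $p$ row indexes such that the corresponding rows of $U$ form a full rank $p\times p$ submatrix of $U$. Then the map $$\varphi_U:W_{I_p}\to St_p^n,\qquad \varphi_U(\Omega):=\mathcal C(\Omega)U,$$ is smooth, satisfies $\varphi_U(\mathbf 0)=U$, and is a local chart (local parametrization) of $St_p^n$ around $U$, i.e. it restricts to a diffeomorphism from an open neighbourhood of $\mathbf 0$ in $W_{I_p}$ onto an open neighbourhood of $U$ in $St_p^n$.
   Context: $St_p^n=\{U\in\mathcal M_{n\times p}(\mathbb R)\mid U^TU=\mathbb I_p\}$ is the orthogonal Stiefel manifold. $\mathrm{Skew}_{n\times n}(\mathbb R)$ is the space of real skew-symmetric $n\times n$ matrices. $W_{I_p}=\{\Omega=[\omega_{ij}]\in\mathrm{Skew}_{n\times n}(\mathbb R)\mid \omega_{ij}=0\text{ whenever both } i\notin I_p\text{ and } j\notin I_p\}$, a real vector space of dimension $np-\frac{p(p+1)}2$. $\mathcal C(\Omega)=(\mathbb I_n+\Omega)(\mathbb I_n-\Omega)^{-1}$ is the Cayley transform. *)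

(* Defs.v *)
From HB Require Import structures.
From mathcomp Require Import all_boot all_order all_algebra.
From mathcomp Require Import all_classical all_reals all_analysis.

Set Implicit Arguments.
Unset Strict Implicit.
Unset Printing Implicit Defensive.

Import Order.TTheory GRing.Theory Num.Theory.
Import numFieldNormedType.Exports.

Local Open Scope classical_set_scope.
Local Open Scope ring_scope.

Section Smoothness.
Context {R : realType} {V W : normedModType R}.

(* f is C^k on the open set O: at order k+1, f is Fréchet differentiable on O
   and x |-> 'd f x v is C^k for every fixed v.  For finite-dimensional V (the
   only case used) this amounts to 'd f being C^k as a map into the space of
   linear maps. *)
Fixpoint Ck_on (k : nat) (O : set V) (f : V -> W) : Prop :=
  match k with
  | 0 => forall x, O x -> {for x, continuous f}
  | k'.+1 => (forall x, O x -> differentiable f x) /\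
             (forall v : V, Ck_on k' O (fun x => 'd f x v))
  end.

Definition Cinfty_on (O : set V) (f : V -> W) : Prop :=
  forall k, Ck_on k O f.

(* Smoothness on an arbitrary subset A: f extends, locally around each point
   of A, to a C^oo map on an open subset of V.  If A is a linear subspace or an
   embedded submanifold of V (or a relatively open subset of one), this is
   smoothness for the induced manifold structure on A; the same holds for
   maps with values in an embedded submanifold of W. *)
Definition smooth_on (A : set V) (f : V -> W) : Prop :=
  forall x, A x -> exists (O : set V) (g : V -> W),
    [/\ open O, O x, Cinfty_on O g & forall y, A y -> O y -> f y = g y].

End Smoothness.

Definition diffeomorphism {R : realType} {V W : normedModType R}
    (A : set V) (B : set W) (f : V -> W) : Prop :=
  smooth_on A f /\
  exists g : W -> V,
    [/\ smooth_on B g,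
        forall x, A x -> B (f x) /\ g (f x) = x &
        forall y, B y -> A (g y) /\ f (g y) = y].

(* A is open for the subspace topology of X. *)
Definition open_in {T : topologicalType} (X A : set T) : Prop :=
  exists2 O : set T, open O & A = X `&` O.

Definition local_parametrization {R : realType} {V W : normedModType R}
    (X : set V) (Y : set W) (f : V -> W) (x : V) : Prop :=
  exists (A : set V) (B : set W),
    [/\ open_in X A, A x, open_in Y B, B (f x) & diffeomorphism A B f].

Section Stiefel.
Context {R : realType}.

Definition Stiefel (n p : nat) : set 'M[R]_(n, p) :=
  [set U | U^T *m U = 1%:M].

Definition Skew (n : nat) : set 'M[R]_n := [set Omega | Omega^T = - Omega].

Definition WI (n : nat) (I : {set 'I_n}) : set 'M[R]_n :=
  [set Omega | Skew Omega /\
     forall i j, i \notin I -> j \notin I -> Omega i j = 0].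

Definition rows_in (n p : nat) (I : {set 'I_n}) (U : 'M[R]_(n, p)) :
    'M[R]_(#|I|, p) :=
  rowsub (fun k : 'I_#|I| => enum_val k) U.

(* invmx A is A itself when A is not invertible; on skew-symmetric matrices
   this never happens, see Skew_unitmx below. *)
Definition Cayley (n : nat) (Omega : 'M[R]_n) : 'M[R]_n :=
  (1%:M + Omega) *m invmx (1%:M - Omega).

Definition phi (n p : nat) (U : 'M[R]_(n, p)) (Omega : 'M[R]_n) :
    'M[R]_(n, p) :=
  Cayley Omega *m U.

Lemma Skew_unitmx (n : nat) (Omega : 'M[R]_n) :
  Skew Omega -> 1%:M - Omega \in unitmx.
Proof.
move=> skO; rewrite -row_free_unit; apply: inj_row_free => v.
rewrite mulmxBr mulmx1 => /eqP; rewrite subr_eq0 => /eqP vE.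
have vv : v *m v^T = - (v *m v^T).
  have OE : Omega = - Omega^T by rewrite skO opprK.
  have vOv : v *m v^T = v *m Omega *m v^T by rewrite -vE.
  by rewrite [LHS]vOv -mulmxA OE mulNmx mulmxN -trmx_mul -vE.
have vv0 : (v *m v^T) 0 0 = 0.
  move/matrixP/(_ 0 0)/eqP: vv; rewrite [X in _ == X]mxE -addr_eq0 -mulr2n.
  by rewrite mulrn_eq0 /= => /eqP.
apply/rowP => i; rewrite [RHS]mxE; apply/eqP.
move: vv0; rewrite mxE => /psumr_eq0P vv0.
have /vv0 /(_ i isT) : forall j : 'I_n, true -> 0 <= v 0 j * v^T j 0.
  by move=> j _; rewrite mxE -expr2 sqr_ge0.
by move/eqP; rewrite mxE mulf_eq0 orbb.
Qed.

End Stiefel.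

(* Main.v *)
Require Import Defs.
From HB Require Import structures.
From mathcomp Require Import all_boot all_order all_algebra.
From mathcomp Require Import all_classical all_reals all_analysis.

Set Implicit Arguments.
Unset Strict Implicit.
Unset Printing Implicit Defensive.

Import Order.TTheory GRing.Theory Num.Theory.
Import numFieldNormedType.Exports.

Local Open Scope classical_set_scope.
Local Open Scope ring_scope.

(** The inverse of the parametrization is explicit, so no inverse function
    theorem is needed.  For skew [Omega], [phi U Omega = V] means
    [(1 - Omega) V = (1 + Omega) U], i.e. [Omega (U + V) = V - U].  If the rows
    of [S := U + V] indexed by [I] form an invertible matrix, this equation has
    exactly one solution in [WI I]: its entries are rational functions of [V],
    and it is skew because [(V - U)^T (U + V)] is skew when [U] and [V] have
    orthonormal columns.  At [V = U] the selected rows of [S] are twice those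
    of [U], so the condition holds on a neighbourhood of [U]. *)

(** * Calculus of C^k maps on open subsets of a normed space *)

Section CkCalculus.
Context {R : realType} {V : normedModType R}.

(** A differential is determined by the germ: the first-order expansion of [f] at [x] is also one
    for [g], and [diff_unique] identifies the linear part. *)
Lemma near_eq_is_diff {W : normedModType R} (f g : V -> W) (x : V) :
  {near x, f =1 g} -> differentiable f x -> is_diff x g ('d f x).
Proof.
move=> fg df.
have key : g \o shift x = cst (g x) + 'd f x +o_ 0 id.
  apply/eqaddoP => _/posnumP[e].
  have /eqaddoP/(_ e%:num (gt0 e)) fo := diff_locally df.
  have fg0 : \forall h \near (0 : V), f (h + x) = g (h + x).
    by move: fg; rewrite (near_shift 0) subr0; exact.
  have fgx : f x = g x := nbhs_singleton fg.
  near=> h.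
  rewrite !fctE /= -fgx -(near fg0 h) //.
  have : `|(f \o shift x - (cst (f x) + 'd f x)) h| <= e%:num * `|id h|.
    by near: h.
  by [].
have dE := diff_unique (diff_continuous df) key.
apply: DiffDef => //; apply/diff_locallyP.
by rewrite dE; split => //; exact: diff_continuous df.
Unshelve. all: by end_near. Qed.

(** Differentiation rules compute ['d f x v] only for [x] in [O], whereas [Ck_on] speaks of a
    function on all of [V]. This lemma bridges the gap in the inductions below. *)
Lemma Ck_on_ext {W : normedModType R} k (O : set V) (f g : V -> W) :
  open O -> (forall x, O x -> f x = g x) -> Ck_on k O f -> Ck_on k O g.
Proof.
move=> oO; have nearO (h h' : V -> W) : (forall x, O x -> h x = h' x) ->
    forall x, O x -> {near x, h =1 h'}.
  by move=> hh' x Ox; near do apply: hh'; exact: open_nbhs_nbhs.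
elim: k f g => [|k IH] f g fg /=.
  move=> fc x Ox; rewrite /prop_for /continuous_at -fg //.
  by apply: cvg_trans (fc x Ox); apply: near_eq_cvg; exact: nearO.
case=> fd fC.
have gd x : O x -> is_diff x g ('d f x).
  by move=> Ox; apply: near_eq_is_diff (nearO _ _ fg x Ox) (fd x Ox).
split=> [x /gd //|v].
by apply: IH (fC v) => x /gd [_ ->].
Unshelve. all: by end_near. Qed.

(** Product and inverse rules put [f] itself next to its differential, so their inductions must
    lower the order of [f]. *)
Lemma Ck_onW {W : normedModType R} k (O : set V) (f : V -> W) :
  Ck_on k.+1 O f -> Ck_on k O f.
Proof.
elim: k f => [|k IH] f /= [fd fC].
  by move=> x Ox; exact/differentiable_continuous/fd.
by split=> // v; apply: IH; split; have [] := fC v.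
Qed.

Lemma Ck_on_continuous {W : normedModType R} k (O : set V) (f : V -> W) :
  Ck_on k O f -> forall x, O x -> {for x, continuous f}.
Proof. by elim: k => // k IH /Ck_onW/IH. Qed.

Lemma Ck_on_cst {W : normedModType R} k (O : set V) (w : W) :
  Ck_on k O (fun=> w).
Proof.
elim: k w => [|k IH] w /=; first by move=> x _; exact: cst_continuous.
split=> [x _|v]; first exact: differentiable_cst.
by under eq_fun do rewrite diff_cst; exact: IH.
Qed.

Lemma Ck_on_linear_comp {W W' : normedModType R} k (O : set V) (f : V -> W)
    (L : {linear W -> W'}) : open O -> continuous L ->
  Ck_on k O f -> Ck_on k O (fun x => L (f x)).
Proof.
move=> oO Lc; elim: k f => [|k IH] f /=.
  by move=> fC x Ox; apply: continuous_comp (fC x Ox) (Lc _).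
case=> fd fC; have Ld y : differentiable L y by exact: linear_differentiable.
split=> [x Ox|v]; first by apply: differentiable_comp; [exact: fd|].
apply: Ck_on_ext (IH _ (fC v)) => // x Ox.
by rewrite (diff_comp (fd x Ox) (Ld _)) /= diff_lin.
Qed.

Lemma Ck_on_linear {W : normedModType R} k (O : set V) (L : {linear V -> W}) :
  continuous L -> Ck_on k O L.
Proof.
move=> Lc; case: k => [x _|k]; first exact: Lc.
split=> [x _|v]; first exact: linear_differentiable.
by under eq_fun do rewrite diff_lin //; exact: Ck_on_cst.
Qed.

Lemma Ck_on_id k (O : set V) : Ck_on k O (id : V -> V).
Proof. by apply: (@Ck_on_linear _ k O idfun) => x; exact: cvg_id. Qed.

Lemma Ck_onD {W : normedModType R} k (O : set V) (f g : V -> W) : open O ->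
  Ck_on k O f -> Ck_on k O g -> Ck_on k O (fun x => f x + g x).
Proof.
move=> oO; elim: k f g => [|k IH] f g /=.
  by move=> fC gC x Ox; apply: continuousD; [exact: fC|exact: gC].
move=> [fd fC] [gd gC].
split=> [x Ox|v]; first by apply: differentiableD; [exact: fd|exact: gd].
apply: Ck_on_ext (IH _ _ (fC v) (gC v)) => // x Ox.
exact: esym (congr1 (@^~ v) (diffD (fd x Ox) (gd x Ox))).
Qed.

Lemma Ck_onN {W : normedModType R} k (O : set V) (f : V -> W) : open O ->
  Ck_on k O f -> Ck_on k O (fun x => - f x).
Proof.
move=> oO; apply: (Ck_on_linear_comp (L := -%R)) => //; exact: opp_continuous.
Qed.

Lemma Ck_onB {W : normedModType R} k (O : set V) (f g : V -> W) : open O ->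
  Ck_on k O f -> Ck_on k O g -> Ck_on k O (fun x => f x - g x).
Proof. by move=> oO fC gC; apply: Ck_onD => //; exact: Ck_onN. Qed.

Lemma Ck_onM k (O : set V) (f g : V -> R) : open O ->
  Ck_on k O f -> Ck_on k O g -> Ck_on k O (fun x => f x * g x).
Proof.
move=> oO; elim: k f g => [|k IH] f g.
  by move=> fC gC x Ox; apply: continuousM; [exact: fC|exact: gC].
move=> fk gk; have [fd fC] := fk; have [gd gC] := gk.
split=> [x Ox|v]; first by apply: differentiableM; [exact: fd|exact: gd].
apply: Ck_on_ext (Ck_onD oO (IH _ _ (Ck_onW fk) (gC v))
  (IH _ _ (Ck_onW gk) (fC v))) => // x Ox.
exact: esym (congr1 (@^~ v) (diffM (fd x Ox) (gd x Ox))).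
Qed.

Lemma Ck_onV k (O : set V) (f : V -> R) : open O ->
  (forall x, O x -> f x != 0) ->
  Ck_on k O f -> Ck_on k O (fun x => (f x)^-1).
Proof.
move=> oO f0; elim: k => [|k IH].
  by move=> fC x Ox; apply: continuousV; [exact: f0|exact: fC].
move=> fk; have [fd fC] := fk; have Vk := IH (Ck_onW fk).
split=> [x Ox|v]; first by apply: differentiableV; [exact: fd|exact: f0].
(* The derivative of 1/f is -(1/f)^2 df, so the induction hypothesis [Vk] on 1/f is used for both
   factors of the square. *)
apply: Ck_on_ext (Ck_onM oO (Ck_onM oO (Ck_on_cst k O (-1 : R))
  (Ck_onM oO Vk Vk)) (fC v)) => // x Ox.
rewrite mulN1r -expr2 exprVn.
exact: esym (congr1 (@^~ v) (diffV (fd x Ox) (f0 x Ox))).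
Qed.

Lemma Ck_on_sum {W : normedModType R} k (O : set V) (J : Type) (r : seq J)
    (P : pred J) (F : J -> V -> W) : open O ->
  (forall j, Ck_on k O (F j)) ->
  Ck_on k O (fun x => \sum_(j <- r | P j) F j x).
Proof.
move=> oO FC; elim: r => [|j r IH].
  by under eq_fun do rewrite big_nil; exact: Ck_on_cst.
under eq_fun do rewrite big_cons.
by case: (P j) => //; apply: Ck_onD.
Qed.

Lemma Ck_on_prod k (O : set V) (J : Type) (r : seq J)
    (P : pred J) (F : J -> V -> R) : open O ->
  (forall j, Ck_on k O (F j)) ->
  Ck_on k O (fun x => \prod_(j <- r | P j) F j x).
Proof.
move=> oO FC; elim: r => [|j r IH].
  by under eq_fun do rewrite big_nil; exact: Ck_on_cst.
under eq_fun do rewrite big_cons.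
by case: (P j) => //; apply: Ck_onM.
Qed.

Lemma Ck_on_coord m n k (O : set V) (f : V -> 'M[R]_(m, n)) i j : open O ->
  Ck_on k O f -> Ck_on k O (fun x => f x i j).
Proof.
move=> oO.
have lin : linear (fun M : 'M[R]_(m, n) => M i j) by move=> a M N; rewrite !mxE.
pose LM := GRing.isLinear.Build _ _ _ _ _ lin.
pose L : {linear 'M[R]_(m, n) -> R} :=
  HB.pack (fun M : 'M[R]_(m, n) => M i j) LM.
by apply: (Ck_on_linear_comp (L := L)) => //; exact: coord_continuous.
Qed.

(** A matrix is the sum of its entries times elementary matrices, and each [a *: delta_mx i j] is
    continuous and linear in [a]. *)
Lemma Ck_on_mx m n k (O : set V) (f : V -> 'M[R]_(m, n)) : open O ->
  (forall i j, Ck_on k O (fun x => f x i j)) -> Ck_on k O f.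
Proof.
move=> oO fC; under [f]funext do rewrite [f _]matrix_sum_delta.
apply: Ck_on_sum => // i; apply: Ck_on_sum => // j.
have lin : linear (fun a : R => a *: delta_mx i j : 'M[R]_(m, n)).
  by move=> a b c; rewrite scalerDl scalerA.
pose LM := GRing.isLinear.Build _ _ _ _ _ lin.
pose L : {linear R -> 'M[R]_(m, n)} :=
  HB.pack (fun a : R => a *: delta_mx i j : 'M[R]_(m, n)) LM.
by apply: (Ck_on_linear_comp (L := L)) => //; exact: scalel_continuous.
Qed.

Lemma Ck_on_mulmx m n p k (O : set V) (f : V -> 'M[R]_(m, n))
    (g : V -> 'M[R]_(n, p)) : open O ->
  Ck_on k O f -> Ck_on k O g -> Ck_on k O (fun x => f x *m g x).
Proof.
move=> oO fC gC; apply: Ck_on_mx => // i j.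
under eq_fun do rewrite mxE.
by apply: Ck_on_sum => // l; apply: Ck_onM => //; exact: Ck_on_coord.
Qed.

Lemma Ck_on_trmx m n k (O : set V) (f : V -> 'M[R]_(m, n)) : open O ->
  Ck_on k O f -> Ck_on k O (fun x => (f x)^T).
Proof.
move=> oO fC; apply: Ck_on_mx => // i j.
by under eq_fun do rewrite mxE; exact: Ck_on_coord.
Qed.

Lemma Ck_on_det n k (O : set V) (f : V -> 'M[R]_n) : open O ->
  (forall i j, Ck_on k O (fun x => f x i j)) -> Ck_on k O (fun x => \det (f x)).
Proof.
move=> oO fC; apply: Ck_on_sum => // s.
by apply: Ck_onM => //; [exact: Ck_on_cst|exact: Ck_on_prod].
Qed.

(** By the adjugate formula, each entry of the inverse is a cofactor divided by a nonvanishing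
    determinant. *)
Lemma Ck_on_invmx n k (O : set V) (f : V -> 'M[R]_n) : open O ->
  (forall x, O x -> f x \in unitmx) ->
  Ck_on k O f -> Ck_on k O (fun x => invmx (f x)).
Proof.
move=> oO fu fC; have fij i j := Ck_on_coord i j oO fC.
apply: Ck_on_mx => // i j.
apply: (@Ck_on_ext _ _ _ (fun x => (\det (f x))^-1 * (\adj (f x)) i j)) => //.
  by move=> x Ox; rewrite /invmx fu // !mxE.
apply: Ck_onM => //.
  apply: Ck_onV => //; last exact: Ck_on_det.
  by move=> x /fu; rewrite unitmxE unitfE.
under eq_fun do rewrite mxE.
apply: Ck_onM => //; first exact: Ck_on_cst.
by apply: Ck_on_det => // a b; under eq_fun do rewrite !mxE.
Qed.

End CkCalculus.

(** Serves to show that domains cut out by a nonvanishing determinant are open; order 0 is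
    enough. *)
Lemma open_Ck_on_neq0 {R : realType} {V : normedModType R} k (O : set V)
    (h : V -> R) :
  open O -> Ck_on k O h -> open [set x | O x /\ h x != 0].
Proof.
move=> oO /Ck_on_continuous hc; rewrite openE => x [Ox hx] /=.
have nO : nbhs x O by exact: open_nbhs_nbhs.
have nh : nbhs x (h @^-1` [set y | y != 0]).
  by apply: (hc x Ox); apply: open_nbhs_nbhs; split=> //; exact: open_neq.
exact: filterI.
Qed.

(** * The linear equation [Omega *m S = D] for skew matrices of restricted support *)

Section SkewSolve.
Context {R : realType} {n p : nat}.
Variable E : 'M[R]_(p, n).
Hypothesis EE : E *m E^T = 1%:M.
Implicit Types (S D : 'M[R]_(n, p)) (Omega : 'M[R]_n).

(** By [EE] this is the orthogonal projection onto the kernel of [E]. When [E] selects the rows in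
    [I], [Q *m Omega *m Q] is the part of [Omega] with both indices outside [I]. *)
Let Q : 'M[R]_n := 1%:M - E^T *m E.

(* Solves [Omega *m S = D] for [Omega] skew and supported on [I], where [E]
   selects the rows in [I].  [M] vanishes off the columns in [I], [M *m S = D],
   and [N] is the projection onto the column space of [S] satisfying
   [E *m N = E]; the unknown agrees with [M] in the rows outside [I], which
   forces all the rest. *)
Definition skew_solve S D : 'M[R]_n :=
  let M := D *m invmx (E *m S) *m E in
  let N := S *m invmx (E *m S) *m E in
  M - M^T + M^T *m N.

Let EQ : E *m Q = 0.
Proof. by rewrite mulmxBr mulmx1 mulmxA EE mul1mx subrr. Qed.

Let QT : Q^T = Q.
Proof. by rewrite linearB /= trmx1 trmx_mul trmxK. Qed.

Let QEt : Q *m E^T = 0.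
Proof. by apply: trmx_inj; rewrite trmx_mul trmxK QT EQ trmx0. Qed.

(** Since [M *m S = D] and [N *m S = S], the last two terms cancel after multiplication by [S]. *)
Lemma skew_solve_mul S D : E *m S \in unitmx -> skew_solve S D *m S = D.
Proof.
move=> uS; have cancel (A : 'M[R]_(n, p)) : A *m invmx (E *m S) *m E *m S = A.
  by rewrite -!mulmxA mulVmx // mulmx1.
by rewrite /skew_solve mulmxDl mulmxBl -[X in _ + X]mulmxA !cancel subrK.
Qed.

(** [M] ends in [E], so [M *m Q = 0] and, transposing, [Q *m M^T = 0]; each of the three terms
    dies. *)
Lemma skew_solve_supp S D : Q *m skew_solve S D *m Q = 0.
Proof.
have QM (A : 'M[R]_(n, p)) : Q *m (A *m E)^T = 0.
  by rewrite trmx_mul mulmxA QEt mul0mx.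
by rewrite /skew_solve mulmxDr (mulmxBr Q) !mulmxA !QM !mul0mx subr0 addr0 -(mulmxA _ E) EQ mulmx0.
Qed.

(** [M - M^T] is always skew; the hypothesis, conjugated by [T *m E], makes [M^T *m N] skew too. *)
Lemma skew_solve_skew S D : D^T *m S + S^T *m D = 0 -> Skew (skew_solve S D).
Proof.
move=> DS; rewrite /Skew /= /skew_solve.
set T := invmx _; set M := D *m T *m E; set N := S *m T *m E.
have MN : M^T *m N + N^T *m M = 0.
  have -> : M^T *m N + N^T *m M =
      (T *m E)^T *m (D^T *m S + S^T *m D) *m (T *m E).
    by rewrite /M /N !trmx_mul mulmxDr mulmxDl !mulmxA.
  by rewrite DS mulmx0 mul0mx.
have NM : N^T *m M = - (M^T *m N) by apply/eqP; rewrite -addr_eq0 addrC MN.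
by rewrite linearD linearB /= (trmx_mul M^T) !trmxK NM opprD opprB.
Qed.

Lemma skew_supp_eq0 S Omega : E *m S \in unitmx -> Skew Omega ->
  Q *m Omega *m Q = 0 -> Omega *m S = 0 -> Omega = 0.
Proof.
move=> uS skO QOQ OS.
have split_id (A : 'M[R]_n) : A = A *m E^T *m E + A *m Q.
  by rewrite mulmxBr mulmx1 mulmxA addrC subrK.
(* If [A *m Q = 0], then [A] factors through [E], and [A *m S = 0] can be cancelled by the
   invertible [E *m S]. This is applied to [Q *m Omega], then, after skewness turns [Q *m Omega = 0]
   into [Omega *m Q = 0], to [Omega]. *)
have EtE0 (A : 'M[R]_n) : A *m Q = 0 -> A *m S = 0 -> A = 0.
  move=> AQ AS; rewrite (split_id A) AQ addr0.
  have : A *m E^T *m (E *m S) = 0.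
    by move: AS; rewrite {1}(split_id A) AQ addr0 -mulmxA.
  move/(congr1 (mulmx^~ (invmx (E *m S)))); rewrite mulmxK // mul0mx => ->.
  by rewrite mul0mx.
have QO : Q *m Omega = 0 by apply: EtE0; rewrite // -mulmxA OS mulmx0.
apply: EtE0 => //; apply: trmx_inj.
by rewrite trmx_mul QT skO mulmxN QO oppr0 trmx0.
Qed.

Lemma skew_solve_unique S D Omega : E *m S \in unitmx ->
  D^T *m S + S^T *m D = 0 -> Skew Omega -> Q *m Omega *m Q = 0 ->
  Omega *m S = D -> skew_solve S D = Omega.
Proof.
move=> uS DS skO QOQ OS; apply/subr0_eq/(skew_supp_eq0 uS).
- by rewrite /Skew /= linearB /= skO (skew_solve_skew DS) -opprD.
- by rewrite (mulmxBr Q) mulmxBl skew_solve_supp QOQ subrr.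
- by rewrite mulmxBl skew_solve_mul // OS subrr.
Qed.

Lemma Ck_on_skew_solve {V : normedModType R} k (O : set V)
    (f h : V -> 'M[R]_(n, p)) : open O ->
  (forall x, O x -> E *m f x \in unitmx) -> Ck_on k O f -> Ck_on k O h ->
  Ck_on k O (fun x => skew_solve (f x) (h x)).
Proof.
move=> oO fu fC hC.
have TC : Ck_on k O (fun x => invmx (E *m f x) *m E).
  apply: (Ck_on_mulmx oO); last exact: Ck_on_cst.
  by apply: Ck_on_invmx => //; apply: Ck_on_mulmx => //; exact: Ck_on_cst.
have sC (w : V -> 'M[R]_(n, p)) : Ck_on k O w ->
    Ck_on k O (fun x => w x *m invmx (E *m f x) *m E).
  by move=> wC; under eq_fun do rewrite -mulmxA; exact: Ck_on_mulmx.
have MC := sC _ hC; have MtC := Ck_on_trmx oO MC.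
by apply: Ck_onD (Ck_onB oO MC MtC) (Ck_on_mulmx oO MtC (sC _ fC)).
Qed.

End SkewSolve.

(** [Q] is the diagonal indicator matrix of the complement of [I], which turns the entrywise support
    condition into a matrix identity. *)
Lemma WI_supp {R : realType} n (I : {set 'I_n}) (Omega : 'M[R]_n) :
  let E : 'M[R]_(#|I|, n) := rowsub enum_val 1%:M in
  let Q : 'M[R]_n := 1%:M - E^T *m E in
  WI I Omega <-> Skew Omega /\ Q *m Omega *m Q = 0.
Proof.
move=> E Q.
have QE : Q = diag_mx (\row_i (i \notin I)%:R).
  apply/matrixP => i j; rewrite !mxE.
  under eq_bigr do rewrite !mxE.
  rewrite -(big_enum_val (fun k => (k == i)%:R * (k == j)%:R)) /=.
  have [->|ij] := eqVneq i j; last first.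
    rewrite mulr0n big1 ?subr0 // => k _.
    by have [->|] := eqVneq k i; rewrite ?mul0r // (negPf ij) mulr0.
  rewrite mulr1n; have [jI|jI] := boolP (j \in I).
    rewrite (bigD1 j) //= eqxx mul1r big1 ?addr0 ?subrr // => k /andP[_ /negPf->].
    by rewrite mul0r.
  by rewrite big1 ?subr0 // => k kI; rewrite (negPf (memPn jI _ kI)) mul0r.
rewrite /WI /= QE mul_diag_mx mul_mx_diag; split=> -[skO O0]; split=> //.
  apply/matrixP => i j; rewrite !mxE.
  have [|iI] := boolP (i \in I); first by rewrite !mul0r.
  have [|jI] := boolP (j \in I); first by rewrite mulr0.
  by rewrite O0 // mulr0 mul0r.
move=> i j iI jI; move/matrixP/(_ i j): O0; rewrite !mxE iI jI.
by rewrite mul1r mulr1.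
Qed.

(** * The Cayley transform acting on the Stiefel manifold *)

Section Cayley.
Context {R : realType} {n p : nat}.
Implicit Types (U V : 'M[R]_(n, p)) (Omega : 'M[R]_n).

(** [X] is the midpoint of [U] and [phi U Omega]: the two right-hand sides add up to 2X. It removes
    the inverse from later computations. *)
Lemma phi_midpoint U Omega : Skew Omega ->
  exists2 X, U = (1%:M - Omega) *m X & phi U Omega = (1%:M + Omega) *m X.
Proof.
move=> /Skew_unitmx u1; exists (invmx (1%:M - Omega) *m U).
  by rewrite mulKVmx.
by rewrite mulmxA.
Qed.

(** In terms of [X], the Gram matrices of [phi U Omega] and [U] differ only in the order of the
    commuting factors [1%:M - Omega] and [1%:M + Omega]. *)
Lemma Stiefel_phi U Omega : Stiefel U -> Skew Omega -> Stiefel (phi U Omega).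
Proof.
rewrite /Stiefel /= => hU skO; have [X UE ->] := phi_midpoint U skO.
have comm : (1%:M - Omega) *m (1%:M + Omega) =
    (1%:M + Omega) *m (1%:M - Omega).
  rewrite mulmxBl mulmxBr !mulmxDl !mulmxDr !(mulmx1, mul1mx).
  by rewrite opprD !addrA addrK.
rewrite -[RHS]hU UE !trmx_mul linearD linearB /= trmx1 skO opprK.
by rewrite -!mulmxA; congr (_ *m _); rewrite !mulmxA comm.
Qed.

Lemma phi_chord U Omega : Skew Omega ->
  Omega *m (U + phi U Omega) = phi U Omega - U.
Proof.
move=> skO; have [X UE ->] := phi_midpoint U skO; rewrite UE.
rewrite -mulmxDl -mulmxBl mulmxA; congr (_ *m _).
have -> : 1%:M - Omega + (1%:M + Omega) = 1%:M + 1%:M.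
  by rewrite addrACA addNr addr0.
by rewrite opprB [RHS]addrC subrKA mulmxDr mulmx1.
Qed.

(** By [phi_chord], the difference of [phi U Omega] and [V] is fixed by [Omega], hence zero because
    [1%:M - Omega] is invertible. *)
Lemma phi_eq U V Omega : Skew Omega -> Omega *m (U + V) = V - U ->
  phi U Omega = V.
Proof.
move=> skO OUV; have u1 := Skew_unitmx skO.
have OWV : Omega *m (phi U Omega - V) = phi U Omega - V.
  have -> : phi U Omega - V = (U + phi U Omega) - (U + V).
    by rewrite opprD addrACA subrr add0r.
  rewrite mulmxBr phi_chord // OUV.
  by rewrite opprB addrA subrK opprD addrACA subrr add0r.
apply/subr0_eq/(can_inj (mulKmx u1)).
by rewrite mulmx0 mulmxBl mul1mx OWV subrr.
Qed.

(** The compatibility condition of [skew_solve_skew] for [S = U + V], [D = V - U]: the two Gram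
    matrices cancel and only opposite cross terms remain. *)
Lemma Stiefel_chord U V : Stiefel U -> Stiefel V ->
  (V - U)^T *m (U + V) + (U + V)^T *m (V - U) = 0.
Proof.
rewrite /Stiefel /= => hU hV.
have -> : (V - U)^T *m (U + V) = V^T *m U - U^T *m V.
  by rewrite linearB /= mulmxBl !mulmxDr hU hV addrKA.
have -> : (U + V)^T *m (V - U) = U^T *m V - V^T *m U.
  by rewrite [(U + V)^T]linearD /= mulmxDl !mulmxBr hU hV subrKA.
by rewrite addrA subrK subrr.
Qed.

Lemma Ck_on_phi k U (O : set 'M[R]_n) : open O ->
  (forall Omega, O Omega -> 1%:M - Omega \in unitmx) -> Ck_on k O (phi U).
Proof.
move=> oO uO; apply: (Ck_on_mulmx oO); last exact: Ck_on_cst.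
apply: (Ck_on_mulmx oO).
  by apply: (Ck_onD oO); [exact: Ck_on_cst|exact: Ck_on_id].
apply: (Ck_on_invmx oO) => //.
by apply: (Ck_onB oO); [exact: Ck_on_cst|exact: Ck_on_id].
Qed.

End Cayley.

(** * The local chart and its explicit inverse *)

Theorem mainTheorem3 (R : realType) (n p : nat) (hp : (1 <= p <= n)%N)
    (U : 'M[R]_(n, p)) (hU : Stiefel U)
    (I : {set 'I_n}) (hI : #|I| = p) (hrank : \rank (rows_in I U) = p) :
  [/\ forall Omega : 'M[R]_n, WI I Omega -> Stiefel (phi U Omega),
      smooth_on (WI I) (phi U),
      phi U 0 = U &
      local_parametrization (WI I) (@Stiefel R n p) (phi U) 0].
Proof.
(* Replacing [p] by [#|I|] makes [E *m U] square, so the rank hypothesis becomes invertibility. *)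
subst p.
pose E : 'M[R]_(#|I|, n) := rowsub enum_val 1%:M.
have EE : E *m E^T = 1%:M.
  rewrite -rowsubE; apply/matrixP => k l; rewrite !mxE.
  by rewrite (inj_eq enum_val_inj) eq_sym.
have EU : E *m U \in unitmx.
  by rewrite -rowsubE -row_free_unit; apply/eqP.
have WIs (Omega : 'M[R]_n) : WI I Omega -> Skew Omega by case.
have phiS Omega : WI I Omega -> Stiefel (phi U Omega).
  by move=> /WIs; exact: Stiefel_phi.
have WI0 : WI I (0 : 'M[R]_n).
  by split=> [|i j _ _]; rewrite /Skew /= ?mxE // trmx0 oppr0.
have phi0 : phi U 0 = U.
  by rewrite /phi /Cayley addr0 subr0 invmx1 !mul1mx.
pose O1 : set 'M[R]_n := [set Omega | 1%:M - Omega \in unitmx].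
have oO1 : open O1.
  have -> : O1 = [set Omega : 'M[R]_n | setT Omega /\ \det (1%:M - Omega) != 0].
    by apply/seteqP; split=> Omega /=; rewrite /O1 /= unitmxE unitfE; tauto.
  apply: (@open_Ck_on_neq0 _ _ 0) openT _; apply: Ck_on_det openT _ => i j.
  apply: Ck_on_coord openT _.
  by apply: Ck_onB openT _ _; [exact: Ck_on_cst|exact: Ck_on_id].
have phiC k : Ck_on k O1 (phi U) by exact: Ck_on_phi.
have phi_smooth (A : set 'M[R]_n) : A `<=` WI I -> smooth_on A (phi U).
  move=> AW Omega /AW /WIs /Skew_unitmx OmegaO.
  (* The formula for [phi U] is its own ambient extension, on the open set [O1]. *)
  by exists O1, (phi U); split.
split => //; first exact: phi_smooth.
pose O2 : set 'M[R]_(n, #|I|) := [set V | E *m (U + V) \in unitmx].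
have oO2 : open O2.
  have -> : O2 = [set V | setT V /\ \det (E *m (U + V)) != 0].
    by apply/seteqP; split=> V /=; rewrite /O2 /= unitmxE unitfE; tauto.
  apply: (@open_Ck_on_neq0 _ _ 0) openT _; apply: Ck_on_det openT _ => i j.
  apply: Ck_on_coord openT _.
  apply: Ck_on_mulmx openT _ _; first exact: Ck_on_cst.
  by apply: Ck_onD openT _ _; [exact: Ck_on_cst|exact: Ck_on_id].
(* The preimage of [O2] under [phi U], taken inside [O1], where [phi U] is continuous. Skew matrices
   lie in [O1] automatically, which gives [O3P]. *)
pose O3 : set 'M[R]_n :=
  [set Omega | O1 Omega /\ \det (E *m (U + phi U Omega)) != 0].
have oO3 : open O3.
  apply: (open_Ck_on_neq0 (k := 0%N) oO1); apply: (Ck_on_det oO1) => i j.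
  apply: (Ck_on_coord _ _ oO1); apply: (Ck_on_mulmx oO1); first exact: Ck_on_cst.
  by apply: (Ck_onD oO1); [exact: Ck_on_cst|exact: phiC].
have O3P Omega : Skew Omega -> O3 Omega <-> O2 (phi U Omega).
  move=> skO; rewrite /O3 /O2 /= unitmxE unitfE; split=> [[]|] // ?; split=> //.
  exact: Skew_unitmx.
have O2U : O2 U.
  rewrite /O2 /= -mulr2n -scaler_nat -scalemxAr unitmxZ //.
  by rewrite unitfE pnatr_eq0.
pose g (V : 'M[R]_(n, #|I|)) := skew_solve E (U + V) (V - U).
have gC k : Ck_on k O2 g.
  apply: (Ck_on_skew_solve oO2) => //.
    by apply: (Ck_onD oO2); [exact: Ck_on_cst|exact: Ck_on_id].
  by apply: (Ck_onB oO2); [exact: Ck_on_id|exact: Ck_on_cst].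
have gW V : Stiefel V -> O2 V -> WI I (g V).
  move=> hV _; apply/WI_supp; split; last exact: skew_solve_supp.
  by apply: skew_solve_skew; exact: Stiefel_chord.
have phig V : Stiefel V -> O2 V -> phi U (g V) = V.
  move=> hV OV; apply: phi_eq; first exact/WIs/gW.
  exact: skew_solve_mul.
exists (WI I `&` O3), (@Stiefel R n #|I| `&` O2); split.
- by exists O3.
- by split=> //; apply/O3P; [exact: WIs|rewrite phi0].
- by exists O2.
- by rewrite phi0.
split; first by apply: phi_smooth => Omega [].
exists g; split.
- by move=> V [hV OV]; exists O2, g; split.
- move=> Omega [WO OO]; have skO := WIs _ WO.
  have OV : O2 (phi U Omega) by apply/O3P.
  split; first by split=> //; exact: phiS.
  (* [Omega] itself solves the equation that defines [g (phi U Omega)], so uniqueness gives back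
     [Omega]. *)
  apply: skew_solve_unique => //; last exact: phi_chord.
    by apply: Stiefel_chord => //; exact: phiS.
  by have [] := (WI_supp I Omega).1 WO.
- move=> V [hV OV]; split; last exact: phig.
  split; first exact: gW.
  by apply/O3P; [exact/WIs/gW|rewrite phig].
Qed.
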